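(* Let $f_1,\dots,f_m$, $g_1,\dots,g_p$, $h_1,\dots,h_q$ be functions $\mathbb{R}^n\to\mathbb{R}$, and consider the constrained multiobjective problem $(f,g,h)$ of minimizing $f=(f_1,\dots,f_m)$ subject to $g_i(x)\le 0$ ($i=1,\dots,p$) and $h_j(x)=0$ ($j=1,\dots,q$). Let $\varphi_i:\mathrm{Im}(f_i)\to\mathbb{R}$, $i=1,\dots,m$, be strictly increasing, let $\tau_i:\mathrm{Im}(g_i)\to\mathbb{R}$, $i=1,\dots,p$, be sign-preserving, and let $\tau_j':\mathrm{Im}(h_j)\to\mathbb{R}$, $j=1,\dots,q$, be zero-only-at-zero. Then the problem $(f,g,h)$ and the transformed problem $$\big((\varphi_1\circ f_1,\dots,\varphi_m\circ f_m),\ (\tau_1\circ g_1,\dots,\tau_p\circ g_p),\ (\tau_1'\circ h_1,\dots,\tau_q'\circ h_q)\big)$$ have the same Pareto set.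
   Context: $\mathrm{Im}(u)$ denotes the image of a function $u:\mathbb{R}^n\to\mathbb{R}$. A function $\tau$ (on a subset of $\mathbb{R}$) is sign-preserving if for all $t$ in its domain, $\tau(t)>0$ if and only if $t>0$. A function $\tau'$ is zero-only-at-zero if for all $t$ in its domain, $\tau'(t)=0$ if and only if $t=0$. For a problem $(f,g,h)$, the feasible set is $C=\{x\in\mathbb{R}^n : g_i(x)\le 0\ \forall i,\ h_j(x)=0\ \forall j\}$. A point $y$ dominates $x$ (with respect to $f$) if $f_i(y)\le f_i(x)$ for all $i$ and $f_j(y)<f_j(x)$ for some $j$. The Pareto set is the set of all $x\in C$ such that no $y\in C$ dominates $x$. *)

(* Defs.v *)
From mathcomp Require Import all_boot all_order all_algebra.
From mathcomp Require Import boolp classical_sets reals.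

Set Implicit Arguments.
Unset Strict Implicit.
Unset Printing Implicit Defensive.

Import Order.TTheory GRing.Theory Num.Theory.
Local Open Scope classical_set_scope.
Local Open Scope ring_scope.

(* A set [D : set R] is used as a type through the coercion [set_type], so
   [D -> R] is the type of functions defined on [D] only. *)
Definition strictly_increasing (R : realType) (D : set R) (phi : D -> R) :=
  forall s t : D, val s < val t -> phi s < phi t.

Definition sign_preserving (R : realType) (D : set R) (tau : D -> R) :=
  forall t : D, 0 < tau t <-> 0 < val t.

Definition zero_only_at_zero (R : realType) (D : set R) (tau : D -> R) :=
  forall t : D, tau t = 0 <-> val t = 0.

(* The composite of [phi : Im u -> V] with [u]. *)
Definition comp_range (T U V : Type) (u : T -> U) (phi : range u -> V) : T -> V :=
  fun x => phi (SigSub (mem_set (imageT u x))).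

Section Pareto.
Variables (R : realType) (n m p q : nat).

Definition feasible_set (g : 'I_p -> 'rV[R]_n -> R) (h : 'I_q -> 'rV[R]_n -> R) :
    set 'rV[R]_n :=
  [set x | (forall i, g i x <= 0) /\ (forall j, h j x = 0)].

Definition dominates (f : 'I_m -> 'rV[R]_n -> R) (y x : 'rV[R]_n) : Prop :=
  (forall i, f i y <= f i x) /\ (exists j, f j y < f j x).

Definition pareto_set (f : 'I_m -> 'rV[R]_n -> R)
    (g : 'I_p -> 'rV[R]_n -> R) (h : 'I_q -> 'rV[R]_n -> R) : set 'rV[R]_n :=
  [set x | feasible_set g h x /\
           ~ (exists y, feasible_set g h y /\ dominates f y x)].

End Pareto.

(* Main.v *)
Require Import Defs.
From mathcomp Require Import all_boot all_order all_algebra.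
From mathcomp Require Import boolp classical_sets reals.

Set Implicit Arguments.
Unset Strict Implicit.
Unset Printing Implicit Defensive.

Import Order.TTheory GRing.Theory Num.Theory.
Local Open Scope classical_set_scope.
Local Open Scope ring_scope.

(** The Pareto set depends on the data only through three kinds of atomic facts: comparisons
    [f i y <= f i x] and [f i y < f i x], the signs [g i x <= 0], and the equations [h j x = 0].
    Each transformation leaves the truth of its atoms unchanged ([comp_range_lt], [comp_range_le],
    [comp_range_le0], [comp_range_eq0]), so feasibility and dominance are literally the same
    predicates for both problems. *)

Section Transformation.
Variables (R : realType) (T : Type) (u : T -> R).

(** Since the order on [R] is total, a strictly increasing map also reflects [<]: if [u y <= u x],
    then equality or strict inequality passes to the images. *)
Lemma comp_range_lt (phi : range u -> R) : strictly_increasing phi ->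
  forall x y, (comp_range phi x < comp_range phi y) = (u x < u y).
Proof.
move=> phi_incr x y; apply/idP/idP => [|uxy]; last exact: phi_incr.
apply: contraLR; rewrite -!leNgt le_eqVlt => /predU1P[uxy|uyx].
  (* The arguments of [phi] carry different membership proofs, so [u y = u x] cannot simply be
     rewritten; elements of the subtype with equal values are equal. *)
  rewrite /comp_range; set s := SigSub _; set t := SigSub _.
  by rewrite (_ : s = t) //; apply: val_inj.
by apply/ltW/phi_incr.
Qed.

Lemma comp_range_le (phi : range u -> R) : strictly_increasing phi ->
  forall x y, (comp_range phi x <= comp_range phi y) = (u x <= u y).
Proof. by move=> phi_incr x y; rewrite !leNgt comp_range_lt. Qed.

(** Being [<= 0] is the negation of being positive, which is exactly what [tau] preserves and
    reflects. *)
Lemma comp_range_le0 (tau : range u -> R) : sign_preserving tau ->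
  forall x, (comp_range tau x <= 0) = (u x <= 0).
Proof.
move=> tau_sign x; rewrite !leNgt; congr negb.
by have [? ?] := tau_sign (SigSub (mem_set (imageT u x))); apply/idP/idP.
Qed.

(** An equality of propositions rather than an equivalence, so that it can be used for rewriting. *)
Lemma comp_range_eq0 (tau : range u -> R) : zero_only_at_zero tau ->
  forall x, (comp_range tau x = 0) = (u x = 0).
Proof. by move=> tau_zero x; apply/propext; exact: tau_zero. Qed.

End Transformation.

Theorem proposition3p3 (R : realType) (n m p q : nat)
    (f : 'I_m -> 'rV[R]_n -> R)
    (g : 'I_p -> 'rV[R]_n -> R)
    (h : 'I_q -> 'rV[R]_n -> R)
    (phi : forall i : 'I_m, range (f i) -> R)
    (tau : forall i : 'I_p, range (g i) -> R)
    (tau' : forall j : 'I_q, range (h j) -> R)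
    (phi_incr : forall i, strictly_increasing (@phi i))
    (tau_sign : forall i, sign_preserving (@tau i))
    (tau'_zero : forall j, zero_only_at_zero (@tau' j)) :
  pareto_set f g h =
  pareto_set (fun i => comp_range (@phi i))
             (fun i => comp_range (@tau i))
             (fun j => comp_range (@tau' j)).
Proof.
have feasibleE : feasible_set (fun i => comp_range (@tau i))
    (fun j => comp_range (@tau' j)) = feasible_set g h.
  apply/funext => x; rewrite /feasible_set /mkset; congr and.
    by apply: eq_forall => i; rewrite comp_range_le0.
  by apply: eq_forall => j; rewrite comp_range_eq0.
(* Dominance agrees on all pairs of points, feasible or not, since each clause compares two values
   of a single objective. *)
have dominatesE : dominates (fun i => comp_range (@phi i)) = dominates f.
  apply/funext => y; apply/funext => x; rewrite /dominates; congr and.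
    by apply: eq_forall => i; rewrite comp_range_le.
  by apply: eq_exists => j; rewrite comp_range_lt.
by rewrite /pareto_set feasibleE dominatesE.
Qed.
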